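(* Let $k \geq 3$ be an integer, let $\phi$ be a satisfiable E$k$-CNF formula, and let $\alpha_{\mathsf{start}}$ and $\alpha_{\mathsf{end}}$ be two satisfying assignments for $\phi$. Then there exists a reconfiguration sequence $\vec{\alpha}$ from $\alpha_{\mathsf{start}}$ to $\alpha_{\mathsf{end}}$ of length polynomial in the size of $\phi$ such that $$\mathrm{val}_\phi(\vec{\alpha}) \geq 1 - \frac{1}{k-1} - \frac{1}{k}.$$ Moreover, such a sequence $\vec{\alpha}$ can be found by a deterministic polynomial-time algorithm. In particular, this is a deterministic $\left(1-\frac{1}{k-1}-\frac{1}{k}\right)$-factor approximation algorithm for Maxmin E$k$-SAT Reconfiguration.
   Context: An E$k$-CNF formula is a conjunction of clauses, each of which is a disjunction of exactly $k$ literals (a literal is a Boolean variable $x_i$ or its negation $\bar{x_i}$). An assignment is a map from the variables to $\{0,1\}$. For a CNF formula $\phi$ with $m$ clauses $C_1,\dots,C_m$ and an assignment $\alpha$, $\mathrm{val}_\phi(\alpha)$ is the fraction of clauses of $\phi$ satisfied by $\alpha$. A reconfiguration sequence from $\alpha_{\mathsf{start}}$ to $\alpha_{\mathsf{end}}$ is a sequence $\vec{\alpha}=(\alpha^{(1)},\dots,\alpha^{(T)})$ of assignments with $\alpha^{(1)}=\alpha_{\mathsf{start}}$, $\alpha^{(T)}=\alpha_{\mathsf{end}}$, and every two consecutive assignments differing in at most one variable; its value is $\mathrm{val}_\phi(\vec{\alpha}) = \min_{t} \mathrm{val}_\phi(\alpha^{(t)})$. The Maxmin E$k$-SAT Reconfiguration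 problem: given a satisfiable E$k$-CNF formula $\phi$ and two satisfying assignments $\alpha_{\mathsf{start}},\alpha_{\mathsf{end}}$, find a reconfiguration sequence from $\alpha_{\mathsf{start}}$ to $\alpha_{\mathsf{end}}$ maximizing $\mathrm{val}_\phi(\vec{\alpha})$. *)

(* Defs.v *)
From mathcomp Require Import all_boot all_order all_algebra.

Set Implicit Arguments.
Unset Strict Implicit.
Unset Printing Implicit Defensive.

Import Order.TTheory GRing.Theory Num.Theory.
Local Open Scope nat_scope.

(* [(i, true)] is the literal x_i and [(i, false)] its negation. *)
Definition literal (n : nat) : Type := ('I_n * bool)%type.
Definition clause (n : nat) : Type := seq (literal n).
(* A list, so that the same clause may occur several times. *)
Definition cnf (n : nat) : Type := seq (clause n).
Definition assignment (n : nat) : Type := {ffun 'I_n -> bool}.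

(* The k literals of a clause are pairwise distinct; a clause may contain a
   variable together with its negation. *)
Definition is_EkCNF (k n : nat) (phi : cnf n) : bool :=
  all (fun C : seq ('I_n * bool) => uniq C && (size C == k)) phi.

Definition sat_clause n (a : assignment n) (C : clause n) : bool :=
  has (fun l : literal n => a l.1 == l.2) C.
Definition satisfies n (phi : cnf n) (a : assignment n) : bool :=
  all (sat_clause a) phi.
Definition satisfiable n (phi : cnf n) : Prop := exists a, satisfies phi a.

(* The empty formula, for which the fraction is 0/0, gets value 1. *)
Definition val_cnf n (phi : cnf n) (a : assignment n) : rat :=
  if phi is [::] then 1%R
  else ((count (sat_clause a) phi)%:R / (size phi)%:R)%R.

(* Values never exceed 1, so starting the minimum at 1 is harmless. *)
Definition val_seq n (phi : cnf n) (s : seq (assignment n)) : rat :=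
  \big[Order.min/1%R]_(a <- s) val_cnf phi a.

Definition adjacent n : rel (assignment n) :=
  fun a b => #|[set i | a i != b i]| <= 1.

Definition reconf_seq n (a_start a_end : assignment n)
    (s : seq (assignment n)) : Prop :=
  [/\ ohead s = Some a_start, last a_start s = a_end & sorted (@adjacent n) s].

Definition is_instance k n (phi : cnf n) (a_start a_end : assignment n) : Prop :=
  [/\ is_EkCNF k phi, satisfiable phi, satisfies phi a_start
    & satisfies phi a_end].

Definition is_opt n (phi : cnf n) (a_start a_end : assignment n) (v : rat) :
    Prop :=
  (exists2 s, reconf_seq a_start a_end s & val_seq phi s = v) /\
  (forall s, reconf_seq a_start a_end s -> (val_seq phi s <= v)%R).

(* Number of variables plus number of literal occurrences. *)
Definition cnf_size n (phi : cnf n) : nat := n + sumn (map size phi).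

(* Jones' WHILE language over binary trees, with its usual time measure: one
   unit per operator of an evaluated expression, per assignment and per test.
   With trees stored as shared pointers each such operation is a
   constant-time pointer manipulation, and polynomial time in this model is
   polynomial time on Turing machines. *)
Inductive tree : Type := Leaf | Node of tree & tree.

Inductive expr : Type :=
  | EVar of nat
  | ELeaf
  | ECons of expr & expr
  | EHd of expr
  | ETl of expr.

Inductive cmd : Type :=
  | Assign of nat & expr
  | Seq of cmd & cmd
  | If of expr & cmd & cmd
  | While of expr & cmd.

Definition store : Type := nat -> tree.

Definition hd_tree (t : tree) : tree := if t is Node l _ then l else Leaf.
Definition tl_tree (t : tree) : tree := if t is Node _ r then r else Leaf.

Fixpoint eval (st : store) (e : expr) : tree :=
  match e with
  | EVar x => st x
  | ELeaf => Leaf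
  | ECons e1 e2 => Node (eval st e1) (eval st e2)
  | EHd e1 => hd_tree (eval st e1)
  | ETl e1 => tl_tree (eval st e1)
  end.

Fixpoint expr_cost (e : expr) : nat :=
  match e with
  | EVar _ | ELeaf => 1
  | ECons e1 e2 => (expr_cost e1 + expr_cost e2).+1
  | EHd e1 | ETl e1 => (expr_cost e1).+1
  end.

Definition update (st : store) (x : nat) (t : tree) : store :=
  fun y => if y == x then t else st y.

(* [exec c st t st']: from store [st], command [c] halts in store [st'] after
   time [t].  A test succeeds when its value is not [Leaf]. *)
Inductive exec : cmd -> store -> nat -> store -> Prop :=
  | ExecAssign x e st :
      exec (Assign x e) st (expr_cost e).+1 (update st x (eval st e))
  | ExecSeq c1 c2 st t1 st1 t2 st2 :
      exec c1 st t1 st1 -> exec c2 st1 t2 st2 ->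
      exec (Seq c1 c2) st (t1 + t2) st2
  | ExecIfTrue e c1 c2 st t st1 :
      eval st e <> Leaf -> exec c1 st t st1 ->
      exec (If e c1 c2) st ((expr_cost e).+1 + t) st1
  | ExecIfFalse e c1 c2 st t st1 :
      eval st e = Leaf -> exec c2 st t st1 ->
      exec (If e c1 c2) st ((expr_cost e).+1 + t) st1
  | ExecWhileTrue e c st t1 st1 t2 st2 :
      eval st e <> Leaf -> exec c st t1 st1 -> exec (While e c) st1 t2 st2 ->
      exec (While e c) st ((expr_cost e).+1 + t1 + t2) st2
  | ExecWhileFalse e c st :
      eval st e = Leaf ->
      exec (While e c) st (expr_cost e).+1 st.

Lemma exec_deterministic c st t1 st1 t2 st2 :
  exec c st t1 st1 -> exec c st t2 st2 -> t1 = t2 /\ st1 = st2.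
Proof.
move=> H; elim: H t2 st2 => {c st t1 st1}.
- by move=> x e st t2 st2 H; inversion H; subst.
- move=> c1 c2 st u1 s1 u2 s2 _ IH1 _ IH2 t2 st2 H; inversion H; subst.
  match goal with h : exec c1 _ _ _ |- _ => case: (IH1 _ _ h) => ? ?; subst end.
  by match goal with h : exec c2 _ _ _ |- _ =>
       case: (IH2 _ _ h) => ? ?; subst end.
- move=> e c1 c2 st u1 s1 nz _ IH1 t2 st2 H; inversion H; subst => //.
  by match goal with h : exec c1 _ _ _ |- _ =>
       case: (IH1 _ _ h) => ? ?; subst end.
- move=> e c1 c2 st u1 s1 nz _ IH1 t2 st2 H; inversion H; subst => //.
  by match goal with h : exec c2 _ _ _ |- _ =>
       case: (IH1 _ _ h) => ? ?; subst end.
- move=> e c st u1 s1 u2 s2 nz _ IH1 _ IH2 t2 st2 H; inversion H; subst => //.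
  match goal with h : exec c _ _ _ |- _ => case: (IH1 _ _ h) => ? ?; subst end.
  by match goal with h : exec (While e c) _ _ _ |- _ =>
       case: (IH2 _ _ h) => ? ?; subst end.
- by move=> e c st z t2 st2 H; inversion H; subst.
Qed.

(* Variable indices are written in unary.  The assignments in the input list
   all n bits, so this changes the input length only polynomially. *)
Definition enc_nat (m : nat) : tree := iter m (Node Leaf) Leaf.
Definition enc_bool (b : bool) : tree := if b then Node Leaf Leaf else Leaf.
Definition enc_list (T : Type) (enc : T -> tree) (s : seq T) : tree :=
  foldr (fun x t => Node (enc x) t) Leaf s.
Definition enc_literal n (l : literal n) : tree :=
  Node (enc_nat l.1) (enc_bool l.2).
Definition enc_cnf n (phi : cnf n) : tree :=
  enc_list (enc_list (@enc_literal n)) phi.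
Definition enc_assignment n (a : assignment n) : tree :=
  enc_list (fun i => enc_bool (a i)) (enum 'I_n).
Definition enc_instance n (phi : cnf n) (a_start a_end : assignment n) : tree :=
  Node (enc_cnf phi) (Node (enc_assignment a_start) (enc_assignment a_end)).

(* Variable 0 holds the input at the start and the output at the end. *)
Definition init_store (t : tree) : store := update (fun _ => Leaf) 0 t.
Definition outputs_in_time (c : cmd) (input : tree) (t : nat) (output : tree) :
    Prop :=
  exists2 st, exec c (init_store input) t st & st 0 = output.

(* [c] runs in polynomial time and maps every instance of Maxmin Ek-SAT
   Reconfiguration to a sequence of assignments satisfying [P]. *)
Definition finds_in_poly_time (k : nat) (c : cmd)
    (P : forall n, cnf n -> assignment n -> assignment n ->
         seq (assignment n) -> Prop) : Prop :=
  exists q : {poly nat}, forall n (phi : cnf n) (a_start a_end : assignment n),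
    is_instance k phi a_start a_end ->
    exists s t, [/\ outputs_in_time c (enc_instance phi a_start a_end) t
                      (enc_list (@enc_assignment n) s),
                    t <= q.[cnf_size phi]%R & P n phi a_start a_end s].

Definition is_approx_algorithm (k : nat) (rho : rat) (c : cmd) : Prop :=
  finds_in_poly_time k c (fun n phi a_start a_end s =>
    reconf_seq a_start a_end s /\
    exists2 v, is_opt phi a_start a_end v & (rho * v <= val_seq phi s)%R).

Definition approx_factor (k : nat) : rat :=
  (1 - 1 / (k%:R - 1) - 1 / k%:R)%R.

(* Main.v *)
Require Import Defs.
From Stdlib Require Import Classical_Prop.
From mathcomp Require Import all_boot all_order all_algebra zify lra.

(* Move a copy [a] of the start assignment and a copy [b] of the end assignment
   towards each other: at each of [n] steps choose an undecided variable and a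
   final value for it, in both copies.  Call a literal decided if its variable
   is.  A clause has risk 0 for [a] if it has a decided true literal, 1/r if it
   is satisfied otherwise and has r undecided literals, and 1 if it is falsified.
   Averaged over all possible choices the risk of a clause does not increase, so
   some choice keeps the total risk of [a] and [b] at most its initial value
   2m/k; hence no assignment on the way falsifies more than 2m/k of the m
   clauses, and 2/k <= 1/(k-1) + 1/k.

   For the running time, the algorithm is written in a functional language whose
   only loops are folds over lists extracted from the input.  Such programs run
   in polynomial time by their shape alone, and they are compiled to WHILE. *)

Set Implicit Arguments.
Unset Strict Implicit.
Unset Printing Implicit Defensive.

Import Order.TTheory GRing.Theory Num.Theory.
Local Open Scope nat_scope.

(** * A functional language with polynomial-time folds *)

(* Variables are de Bruijn indices.  [TFold e e0 b] folds [b] over the list [e]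
   starting from [e0]; in [b], index 0 is the accumulator and index 1 the part
   of the list that starts at the current element. *)
Inductive term : Type :=
  | TE of expr
  | TLet of term & term
  | TIf of expr & term & term
  | TFold of expr & expr & term.

(** [f] receives the whole remaining list, because the length of its tail later serves as a variable
    index. *)
Fixpoint foldt (f : tree -> tree -> tree) (y acc : tree) : tree :=
  if y is Node _ y' then foldt f y' (f y acc) else acc.

Local Notation evale env := (eval (nth Leaf env)).

Fixpoint ev (env : seq tree) (t : term) : tree :=
  match t with
  | TE e => evale env e
  | TLet t1 t2 => ev (ev env t1 :: env) t2
  | TIf e t1 t2 => if evale env e is Node _ _ then ev env t1 else ev env t2
  | TFold e e0 b =>
      foldt (fun y acc => ev [:: acc, y & env] b) (evale env e) (evale env e0)
  end.

Fixpoint vars_in (P : pred nat) (e : expr) : bool :=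
  match e with
  | EVar x => P x
  | ELeaf => true
  | ECons e1 e2 => vars_in P e1 && vars_in P e2
  | EHd e1 | ETl e1 => vars_in P e1
  end.

(* [ro] marks the read-only indices, whose values are parts of the input; only
   these may be folded over. *)
Fixpoint wf (ro : seq bool) (t : term) : bool :=
  match t with
  | TE e => vars_in (fun x => x < size ro) e
  | TLet t1 t2 => wf ro t1 && wf (false :: ro) t2
  | TIf e t1 t2 =>
      [&& vars_in (fun x => x < size ro) e, wf ro t1 & wf ro t2]
  | TFold e e0 b =>
      [&& vars_in (nth false ro) e, vars_in (fun x => x < size ro) e0
        & wf [:: false, true & ro] b]
  end.

(** Levels count from the bottom, so a bound value keeps its WHILE variable while the environment
    grows. *)
Fixpoint to_levels (d : nat) (e : expr) : expr :=
  match e with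
  | EVar x => EVar (d - x.+1)
  | ELeaf => ELeaf
  | ECons e1 e2 => ECons (to_levels d e1) (to_levels d e2)
  | EHd e1 => EHd (to_levels d e1)
  | ETl e1 => ETl (to_levels d e1)
  end.

(* At depth [d] the environment occupies the WHILE variables below [d], the
   result is left in [d], and everything above [d] is scratch. *)
Fixpoint compile (d : nat) (t : term) : cmd :=
  match t with
  | TE e => Assign d (to_levels d e)
  | TLet t1 t2 =>
      Seq (compile d t1) (Seq (compile d.+1 t2) (Assign d (EVar d.+1)))
  | TIf e t1 t2 => If (to_levels d e) (compile d t1) (compile d t2)
  | TFold e e0 b =>
      Seq (Assign d.+1 (to_levels d e0))
     (Seq (Assign d (to_levels d e))
     (Seq (While (EVar d)
             (Seq (compile d.+2 b)
             (Seq (Assign d.+1 (EVar d.+2)) (Assign d (ETl (EVar d))))))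
          (Assign d (EVar d.+1))))
  end.

(* The length of the longest right spine occurring in [t], so that it bounds
   the length of every list obtained from [t] by taking heads and tails. *)
Fixpoint rdepth (t : tree) : nat :=
  if t is Node l r then maxn (rdepth l) (rdepth r).+1 else 0.

Fixpoint slen (t : tree) : nat := if t is Node _ r then (slen r).+1 else 0.

Fixpoint ncons (e : expr) : nat :=
  match e with
  | EVar _ | ELeaf => 0
  | ECons e1 e2 => (ncons e1 + ncons e2).+1
  | EHd e1 | ETl e1 => ncons e1
  end.

(** [W] bounds the spines of the read-only values. In a fold, 7 pays for the test and the two
    assignments of an iteration, 6 for set-up, last test and result. *)
Fixpoint cost (W : nat) (t : term) : nat :=
  match t with
  | TE e => (expr_cost e).+1
  | TLet t1 t2 => cost W t1 + cost W t2 + 2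
  | TIf e t1 t2 => (expr_cost e).+1 + cost W t1 + cost W t2
  | TFold e e0 b =>
      expr_cost e0 + expr_cost e + (W + ncons e) * (cost (W + ncons e) b + 7) + 6
  end.

Lemma slen_le_rdepth t : slen t <= rdepth t.
Proof. by elim: t => //= l _ r IH; rewrite leq_max ltnS IH orbT. Qed.

Lemma rdepth_tl t : rdepth (tl_tree t) <= rdepth t.
Proof. case: t => //= l r; lia. Qed.

Lemma rdepth_eval env (P : pred nat) e W :
  (forall i, P i -> rdepth (nth Leaf env i) <= W) ->
  vars_in P e -> rdepth (evale env e) <= W + ncons e.
Proof.
move=> ltW; elim: e => //= [x Px|e1 IH1 e2 IH2 /andP[P1 P2]|e IH Pe|e IH Pe].
- by rewrite addn0; exact: ltW.
- have := IH1 P1; have := IH2 P2; lia.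
- have := IH Pe; case: (eval _ e) => //= l r; lia.
- exact: leq_trans (rdepth_tl _) (IH Pe).
Qed.

(** * Correctness and running time of compilation *)

Definition matches (env : seq tree) (st : store) : Prop :=
  forall i, i < size env -> st (size env - i.+1) = nth Leaf env i.

Lemma expr_cost_levels d e : expr_cost (to_levels d e) = expr_cost e.
Proof. by elim: e => //= [e1 -> e2 ->|e ->|e ->]. Qed.

Lemma eval_levels env st e : matches env st ->
  vars_in (fun x => x < size env) e ->
  eval st (to_levels (size env) e) = evale env e.
Proof.
move=> M.
elim: e => [x|//|e1 IH1 e2 IH2|e IH|e IH] /=.
- exact: M.
- by case/andP=> /IH1 -> /IH2 ->.
- by move/IH->.
- by move/IH->.
Qed.

Lemma matches_agree env st st' : matches env st ->
  (forall x, x < size env -> st' x = st x) -> matches env st'.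
Proof. move=> M E i li; rewrite E ?M //; lia. Qed.

Lemma matches_cons env st v : matches env st -> st (size env) = v ->
  matches (v :: env) st.
Proof.
move=> M E [|i] /=; first by rewrite subSS subn0.
by rewrite ltnS => /M <-; rewrite subSS.
Qed.

Lemma vars_in_sub (P Q : pred nat) e : (forall x, P x -> Q x) ->
  vars_in P e -> vars_in Q e.
Proof. by move=> PQ; elim: e => //= e1 IH1 e2 IH2 /andP[/IH1 -> /IH2]. Qed.

(** The environment survives because a subprogram leaves all lower variables alone. Folds run over
    read-only values only, so the growth of accumulators never affects the number of iterations. *)
Lemma compile_exec t env ro st W : wf ro t -> matches env st ->
  size ro = size env ->
  (forall i, nth false ro i -> rdepth (nth Leaf env i) <= W) ->
  exists T st', [/\ exec (compile (size env) t) st T st', T <= cost W t,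
    st' (size env) = ev env t & forall x, x < size env -> st' x = st x].
Proof.
elim: t env ro st W => [e|t1 IH1 t2 IH2|e t1 IH1 t2 IH2|e e0 b IHb] env ro st W /=.
- move=> We M E roW; rewrite E in We; do 2!eexists; split; first exact: ExecAssign.
  + by rewrite expr_cost_levels.
  + by rewrite /update eqxx eval_levels.
  + by move=> x lx; rewrite /update ltn_eqF.
- move=> /andP[W1 W2] M E roW.
  have [T1 [st1 [X1 C1 V1 F1]]] := IH1 _ _ _ _ W1 M E roW.
  have M1 : matches (ev env t1 :: env) st1.
    by apply: matches_cons => //; apply: matches_agree M F1.
  have [||T2 [st2 [X2 C2 V2 F2]]] := IH2 _ _ _ W W2 M1; first by rewrite /= E.
    by case=> //= i; exact: roW.
  do 2!eexists; split.
  + by apply: ExecSeq X1 _; apply: ExecSeq X2 _; apply: ExecAssign.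
  + move=> /=; lia.
  + by rewrite /update eqxx /= V2.
  + by move=> x lx; rewrite /update ltn_eqF // F2 ?F1 //= ltnW.
- move=> /and3P[We W1 W2] M E roW; rewrite E in We.
  have [T1 [st1 [X1 C1 V1 F1]]] := IH1 _ _ _ _ W1 M E roW.
  have [T2 [st2 [X2 C2 V2 F2]]] := IH2 _ _ _ _ W2 M E roW.
  have Ee := eval_levels M We.
  case Ev : (evale env e) => [|l r].
  + do 2!eexists; split; [apply: ExecIfFalse X2| | |];
      rewrite ?Ee ?Ev ?expr_cost_levels //; lia.
  + do 2!eexists; split; [apply: ExecIfTrue X1| | |];
      rewrite ?Ee ?Ev ?expr_cost_levels //; lia.
- move=> /and3P[We W0 Wb] M E roW; rewrite E in W0.
  set d := size env.
  have We' : vars_in (fun x => x < d) e.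
    apply: vars_in_sub We => x; rewrite /d -E => rx; rewrite ltnNge.
    by apply/negP => /(nth_default false) Ex; rewrite Ex in rx.
  set body := Seq (compile _ _) _.
  (* Level [d] holds the list still to be read and [d.+1] the accumulator; apart from these, only
     the store below [d] is fixed. *)
  have loop y acc s : rdepth y <= W + ncons e -> (forall x, x < d -> s x = st x) ->
    s d = y -> s d.+1 = acc ->
    exists T s', [/\ exec (While (EVar d) body) s T s',
      T <= slen y * (cost (W + ncons e) b + 7) + 2,
      s' d.+1 = foldt (fun y acc => ev [:: acc, y & env] b) y acc
      & forall x, x < d -> s' x = st x].
    elim: y acc s => [|l _ r IHr] acc s Ly Fs Es Ea /=.
      do 2!eexists; split; first by apply: ExecWhileFalse.
      + by [].
      + by [].
      + by [].
    have Ms : matches (Node l r :: env) s.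
      by apply: matches_cons => //; apply: matches_agree M Fs.
    have Ms' : matches [:: acc, Node l r & env] s by apply: matches_cons.
    have [||T1 [s1 [X1 C1 V1 F1]]] :=
      IHb _ _ _ (W + ncons e) Wb Ms'; first by rewrite /= E.
      by case=> [|[|i]] //= /roW; lia.
    rewrite /= -/d in X1 V1 F1.
    have [||||T2 [s2 [X2 C2 V2 F2]]] := IHr (ev [:: acc, Node l r & env] b)
      (update (update s1 d.+1 (eval s1 (EVar d.+2))) d
         (eval (update s1 d.+1 (eval s1 (EVar d.+2))) (ETl (EVar d)))).
    + by move: Ly => /=; lia.
    + move=> x lx; rewrite /update !ltn_eqF ?(ltnW lx) // ?F1 ?Fs //; lia.
    + by rewrite /update eqxx /= ltn_eqF // F1 // Es.
    + by rewrite /update gtn_eqF // eqxx /= V1.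
    do 2!eexists; split.
    + apply: ExecWhileTrue X2; first by rewrite /= Es.
      by apply: ExecSeq X1 _; apply: ExecSeq; apply: ExecAssign.
    + rewrite /=; lia.
    + by [].
    + by [].
  have rde := rdepth_eval roW We.
  set st1 := update st d.+1 (eval st (to_levels d e0)).
  have M1 : matches env st1.
    by apply: matches_agree M _ => x lx; rewrite /st1 /update ltn_eqF // ltnW.
  set st2 := update st1 d (eval st1 (to_levels d e)).
  have [|||T [st3 [X3 C3 V3 F3]]] := loop _ (evale env e0) st2 rde.
  + by move=> x lx; rewrite /st2 /st1 /update !ltn_eqF // ltnW.
  + by rewrite /st2 /update eqxx eval_levels.
  + by rewrite /st2 /st1 /update gtn_eqF // eqxx eval_levels.
  do 2!eexists; split.
  + apply: ExecSeq; first exact: ExecAssign.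
    apply: ExecSeq; first exact: ExecAssign.
    by apply: ExecSeq X3 _; apply: ExecAssign.
  + have := leq_mul (leq_trans (slen_le_rdepth _) rde)
      (leqnn (cost (W + ncons e) b + 7)).
    rewrite !expr_cost_levels /=; lia.
  + by rewrite /update eqxx /= V3.
  + by move=> x lx; rewrite /update ltn_eqF // F3.
Qed.

(** A fold shifts [W] by a constant, so the induction covers all linear forms [a * x + b]. *)
Lemma cost_horner t a b :
  exists q : {poly nat}, forall x, cost (a * x + b) t = q.[x]%R.
Proof.
elim: t a b => [e|t1 IH1 t2 IH2|e t1 IH1 t2 IH2|e e0 t IH] a b /=.
- by exists ((expr_cost e).+1%:P)%R => x; rewrite hornerC.
- have [q1 E1] := IH1 a b; have [q2 E2] := IH2 a b.
  by exists (q1 + q2 + 2%:P)%R => x; rewrite !hornerD hornerC E1 E2.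
- have [q1 E1] := IH1 a b; have [q2 E2] := IH2 a b.
  exists ((expr_cost e).+1%:P + q1 + q2)%R => x.
  by rewrite !hornerD hornerC E1 E2.
- have [q E] := IH a (b + ncons e).
  exists ((expr_cost e0 + expr_cost e)%:P
    + (a%:P * 'X + (b + ncons e)%:P) * (q + 7%:P) + 6%:P)%R => x.
  by rewrite !(hornerD, hornerM, hornerC, hornerX) -E -(addnA (a * x)).
Qed.

(** * The risk of a clause *)

Local Notation lits C := (C : seq ('I__ * bool)).

Definition upd n (a : assignment n) (v : 'I_n) (b : bool) : assignment n :=
  [ffun i => if i == v then b else a i].

(* [d] marks the variables whose value is already final.  Divided by [L],
   this bounds from above the probability that [C] is ever falsified when the
   remaining variables get random values in random order. *)
Definition risk L n (d a : assignment n) (C : clause n) : nat :=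
  if has (fun l : literal n => d l.1 && (a l.1 == l.2)) C then 0
  else if sat_clause a C then L %/ count (fun l : literal n => ~~ d l.1) C
  else L.

Definition total_risk L n (phi : cnf n) (d a : assignment n) : nat :=
  \sum_(C <- phi) risk L d a C.

Section Risk.

Variables (k L n : nat).
(** A common multiple [L] of 1, ..., [k] turns each weight 1/r into the exact integer [L %/ r]. *)
Hypothesis dvdL : forall r, 0 < r <= k -> r %| L.
Implicit Types (d a : assignment n) (C : clause n) (v : 'I_n) (phi : cnf n).

Lemma risk_le d a C : risk L d a C <= L.
Proof. by rewrite /risk; case: ifP => // _; case: ifP => // _; exact: leq_div. Qed.

Lemma risk_upd_true d a C v b :
  (v, b) \in (lits C) ->
  risk L (upd d v true) (upd a v b) C = 0.
Proof.
move=> vC; rewrite /risk ifT //; apply/hasP; exists (v, b) => //=.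
by rewrite !ffunE !eqxx.
Qed.

Lemma risk_upd_notin d a C v b :
  (forall s, (v, s) \notin (lits C)) ->
  risk L (upd d v true) (upd a v b) C = risk L d a C.
Proof.
move=> vC.
have E (l : 'I_n * bool) : l \in (lits C) -> l.1 != v.
  by case: l => i s lC; apply: contraNneq (vC s) => /= <-.
rewrite /risk /sat_clause.
have -> : has (fun l : literal n => upd d v true l.1 && (upd a v b l.1 == l.2)) C
  = has (fun l : literal n => d l.1 && (a l.1 == l.2)) C.
  by apply: eq_in_has => l /E/negPf ne; rewrite !ffunE ne.
have -> : has (fun l : literal n => upd a v b l.1 == l.2) C
  = has (fun l : literal n => a l.1 == l.2) C.
  by apply: eq_in_has => l /E/negPf ne; rewrite !ffunE ne.
suff -> : count (fun l : literal n => ~~ upd d v true l.1) C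
  = count (fun l : literal n => ~~ d l.1) C by [].
by apply: eq_in_count => l /E/negPf ne; rewrite !ffunE ne.
Qed.

(** Without the opposite literal in [C], deciding [v] removes exactly one undecided literal. *)
Lemma count_upd d C v s : uniq (lits C) -> ~~ d v ->
  (v, s) \in (lits C) -> (v, ~~ s) \notin (lits C) ->
  count (fun l : literal n => ~~ d l.1) C
  = (count (fun l : literal n => ~~ upd d v true l.1) C).+1.
Proof.
move=> uC dv vC vnC.
have -> : count (fun l : literal n => ~~ d l.1) C =
  count (predU (pred1 (v, s)) (fun l : 'I_n * bool => ~~ upd d v true l.1))
    (lits C).
  apply: eq_in_count => -[i t] /= iC; rewrite ffunE.
  case: (eqVneq i v) => [Ei|ne] /=; last by rewrite xpair_eqE (negPf ne).
  subst i; rewrite dv orbF xpair_eqE eqxx /=; apply/esym/eqP.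
  by case: s t vC vnC iC => -[] // _ /negPf ->.
have := count_predUI (pred1 (v, s)) (fun l : 'I_n * bool => ~~ upd d v true l.1)
  (lits C).
rewrite (count_uniq_mem _ uC) vC.
set c := count (predI _ _) _; suff -> : c = 0 by rewrite addn0 add1n.
apply/eqP; rewrite -leqn0 leqNgt -has_count; apply/hasPn => l _ /=.
by rewrite negb_and; case: eqVneq => //= ->; rewrite ffunE eqxx.
Qed.

(* The value falsifying the literal on [v] is harmless as long as another
   literal is still true. *)
Lemma risk_upd_sum_le d a C v :
  uniq (lits C) -> size C <= k -> ~~ d v ->
  (exists2 l : 'I_n * bool, l \in (lits C)
     & (l.1 != v) && (a l.1 == l.2)) ->
  risk L (upd d v true) (upd a v true) C
  + risk L (upd d v true) (upd a v false) C <= 2 * risk L d a C.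
Proof.
move=> uC sC dv [[i t] lC /= /andP[iv /eqP at_]].
have [dtr|ndtr] := boolP (has (fun l : literal n => d l.1 && (a l.1 == l.2)) C).
  suff z b : risk L (upd d v true) (upd a v b) C = 0 by rewrite !z.
  rewrite /risk ifT //; case/hasP: dtr => l lC' /andP[dl al].
  apply/hasP; exists l => //; rewrite !ffunE.
  by case: eqP => [E|_]; [rewrite -E dl in dv | rewrite dl].
have R : risk L d a C = L %/ count (fun l : literal n => ~~ d l.1) C.
  by rewrite /risk (negPf ndtr) ifT //; apply/hasP; exists (i, t) => //=; apply/eqP.
have di : ~~ d i.
  by apply: contra ndtr => di; apply/hasP; exists (i, t); rewrite //= di at_ eqxx.
(* A value that makes a literal on [v] true costs nothing, so only the falsifying value needs a
   bound. *)
suff H s : (v, s) \in (lits C) ->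
  risk L (upd d v true) (upd a v (~~ s)) C <= 2 * risk L d a C.
  case: (boolP ((v, true) \in (lits C))) => vt.
    by rewrite (risk_upd_true _ _ vt); exact: H vt.
  case: (boolP ((v, false) \in (lits C))) => vf.
    by rewrite (risk_upd_true _ _ vf) addn0; exact: (H false).
  by rewrite !risk_upd_notin ?addnn ?mul2n //; case.
move=> vs; have [vns|vns] := boolP ((v, ~~ s) \in (lits C)).
  by rewrite (risk_upd_true _ _ vns).
have [->//|pos] := posnP (risk L (upd d v true) (upd a v (~~ s)) C).
have Ec := count_upd uC dv vs vns.
rewrite /risk; move: pos; rewrite {1}/risk; case: ifP => // _ _.
rewrite ifT; last first.
  by apply/hasP; exists (i, t) => //=; rewrite ffunE (negPf iv) at_.
move: (R); rewrite /risk => ->; rewrite Ec.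
set r := count _ _.
have r0 : 0 < r.
  rewrite -has_count; apply/hasP; exists (i, t) => //=.
  by rewrite ffunE (negPf iv).
have rk : r < k.
  by apply: leq_trans sC; rewrite -/r -Ec count_size.
have /dvdL/dvdnP[x Ex] : 0 < r <= k by rewrite r0 ltnW.
have /dvdL/dvdnP[y Ey] : 0 < r.+1 <= k by [].
(* With denominators cleared this is 1/r <= 2/(r+1), where r >= 1 because the true literal on [i]
   stays undecided. *)
rewrite {1}Ex mulnK // Ey mulnK // -(leq_pmul2r r0) -Ex Ey mulnS -mulnA mul2n -addnn.
by rewrite leq_add2r leq_pmulr.
Qed.

(** If some true literal is on a variable other than [v], the bound holds for [v] by itself. The
    critical case is a single true literal, on [v0], among r undecided ones: [v0] contributes at
    most [L] and each of the r-1 others at most L/(r-1), in total at most 2L = r * 2(L/r). *)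
Lemma sum_risk_upd d a C :
  uniq (lits C) -> size C <= k ->
  \sum_(v | ~~ d v) (risk L (upd d v true) (upd a v true) C
    + risk L (upd d v true) (upd a v false) C)
  <= \sum_(v | ~~ d v) 2 * risk L d a C.
Proof.
move=> uC sC.
have [sat|unsat] := boolP (sat_clause a C); last first.
  apply: leq_sum => v dv.
  have -> : risk L d a C = L.
    rewrite /risk (negPf unsat) ifN //; apply: contra unsat.
    by case/hasP=> l lC /andP[_ al]; apply/hasP; exists l.
  by rewrite mul2n -addnn leq_add ?risk_le.
have /hasP[[v0 s0] l0C /= /eqP as0] := sat; subst s0.
have [|alone] := boolP (has (fun l : 'I_n * bool => (l.1 != v0) && (a l.1 == l.2)) C).
  move=> /hasP[l1 l1C /andP[l1v al1]]; apply: leq_sum => v dv.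
  apply: risk_upd_sum_le => //; have [E|ne] := eqVneq v0 v.
    by exists l1 => //; rewrite -E l1v.
  by exists (v0, a v0); rewrite //= ne eqxx.
have ot v : v != v0 -> ~~ d v ->
  risk L (upd d v true) (upd a v true) C
    + risk L (upd d v true) (upd a v false) C <= 2 * risk L d a C.
  move=> ne dv; apply: risk_upd_sum_le => //.
  by exists (v0, a v0); rewrite //= eq_sym ne eqxx.
have [dv0|dv0] := boolP (d v0).
  by apply: leq_sum => v dv; apply: ot => //; apply: contraNneq dv => ->.
have [pair|single] := boolP ((v0, ~~ a v0) \in (lits C)).
  apply: leq_sum => v dv; have [->|] := eqVneq v v0; last by move/ot; apply.
  by move: l0C pair; case: (a v0) => p q; rewrite !risk_upd_true.
have trueE l : l \in lits C -> a l.1 == l.2 -> l = (v0, a v0).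
  case: l => i s lC /= /eqP as_; congr (_, _); last first.
    by move/hasPn: alone => /(_ _ lC) /=; rewrite as_ eqxx andbT negbK => /eqP <-.
  by move/hasPn: alone => /(_ _ lC) /=; rewrite as_ eqxx andbT negbK => /eqP.
pose U := [seq l <- lits C | ~~ d l.1].
(* Two undecided literals on one variable would include a true one, hence be on [v0], whose opposite
   literal is absent. *)
have uU : uniq (map fst U).
  rewrite map_inj_in_uniq ?filter_uniq // => -[i s] [j t].
  rewrite !mem_filter => /andP[_ iC] /andP[_ jC] /= E; subst j; congr (_, _).
  have [E|ne] := eqVneq i v0.
    subst i; have ok u : (v0, u) \in lits C -> u = a v0.
      by case: (a v0) u single => -[] // /negPf ->.
    by rewrite (ok _ iC) (ok _ jC).
  have ok u : (i, u) \in lits C -> u = ~~ a i.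
    move=> uC'; case: (eqVneq (a i) u) => [E|]; last by case: (a i) u {uC'} => -[].
    by case: (trueE _ uC' (introT eqP E)) ne => -> _; rewrite eqxx.
  by rewrite (ok _ iC) (ok _ jC).
have sU : count (fun l : literal n => ~~ d l.1) C = size U by rewrite size_filter.
have risk0 : risk L d a C = L %/ size U.
  rewrite /risk sat ifN ?sU //; apply/hasPn => l lC /=.
  by apply/negP => /andP[dl /(trueE _ lC) El]; rewrite El (negPf dv0) in dl.
have U0 : 0 < size U.
  by rewrite -sU -has_count; apply/hasP; exists (v0, a v0).
have Uk : size U <= k by apply: leq_trans sC; rewrite -sU count_size.
rewrite (bigID (fun v => v \in map fst U)) /=.
rewrite [X in _ <= X](bigID (fun v => v \in map fst U)) /=.
apply: leq_add; last first.
  apply: leq_sum => v /andP[dv vU]; rewrite !risk_upd_notin ?addnn ?mul2n // => s;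
    apply: contra vU => vC; apply/mapP; exists (v, s) => //;
    by rewrite mem_filter dv.
have v0U : v0 \in map fst U.
  by apply/mapP; exists (v0, a v0); rewrite // mem_filter dv0.
have sumU F : \sum_(v | ~~ d v && (v \in map fst U)) F v = \sum_(v <- map fst U) F v.
  rewrite (big_uniq _ uU) /=; apply: eq_bigl => v.
  apply: andb_idl => /mapP[l]; rewrite mem_filter => /andP[dl _] -> //.
rewrite !sumU.
rewrite (big_rem v0) //= [X in _ <= X]big_const_seq count_predT iter_addn_0 size_map.
have /dvdL/dvdnP[y Ey] : 0 < size U <= k by rewrite U0.
(* One value of [v0] satisfies the clause for good; the other may falsify it. *)
have H1 : risk L (upd d v0 true) (upd a v0 true) C
    + risk L (upd d v0 true) (upd a v0 false) C <= L.
  case E : (a v0) l0C => l0C;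
    rewrite (risk_upd_true _ _ l0C) ?addn0 ?add0n; exact: risk_le.
(* The literal on [v] is false now: making it true costs nothing, and keeping it false leaves one
   undecided literal fewer. *)
have H2 v : v \in rem v0 (map fst U) ->
  risk L (upd d v true) (upd a v true) C
    + risk L (upd d v true) (upd a v false) C <= L %/ (size U).-1.
  rewrite mem_rem_uniq // !inE => /andP[ne /mapP[[i s]]].
  rewrite mem_filter /= => /andP[dv vC] E; subst i.
  have vs : s = ~~ a v.
    case: (eqVneq (a v) s) => [E|]; last by case: (a v) (s) => -[].
    by case: (trueE _ vC (introT eqP E)) ne => -> _; rewrite eqxx.
  have vnC : (v, ~~ s) \notin lits C.
    apply/negP => /trueE /=; rewrite vs negbK eqxx => /(_ isT) [E _].
    by rewrite E eqxx in ne.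
  have Ec := count_upd uC dv vC vnC.
  suff le : risk L (upd d v true) (upd a v (~~ s)) C <= L %/ (size U).-1.
    by case: s vC le {vs vnC Ec} => vC le; rewrite (risk_upd_true _ _ vC) ?addn0.
  rewrite /risk; case: ifP => // _; rewrite ifT; last first.
    by apply/hasP; exists (v0, a v0); rewrite //= ffunE [v0 == v]eq_sym (negPf ne).
  by rewrite -sU Ec.
apply: (@leq_trans (L + \sum_(v <- rem v0 (map fst U)) L %/ (size U).-1)).
  by apply: leq_add => //; rewrite !big_seq; apply: leq_sum => v; exact: H2.
rewrite big_const_seq count_predT iter_addn_0 size_rem // size_map risk0.
have -> : 2 * (L %/ size U) * size U = L + L.
  by rewrite {1}Ey mulnK // -mulnA -Ey mul2n addnn.
(* This includes r = 1, where no other variable is left and [L %/ 0] is 0. *)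
by rewrite leq_add2l leq_trunc_div.
Qed.

(** The clausewise averages add up over all clauses and over both copies, and some choice is no
    worse than the average. *)
Lemma good_move phi d a b :
  is_EkCNF k phi -> (exists v, ~~ d v) ->
  exists v s, ~~ d v /\
    total_risk L phi (upd d v true) (upd a v s)
    + total_risk L phi (upd d v true) (upd b v s)
    <= total_risk L phi d a + total_risk L phi d b.
Proof.
move=> Ek [v0 dv0].
pose F v s := total_risk L phi (upd d v true) (upd a v s)
    + total_risk L phi (upd d v true) (upd b v s).
pose S := total_risk L phi d a + total_risk L phi d b.
have avg : \sum_(v | ~~ d v) (F v true + F v false) <= \sum_(v | ~~ d v) 2 * S.
  have half c : \sum_(v | ~~ d v) (total_risk L phi (upd d v true) (upd c v true)
      + total_risk L phi (upd d v true) (upd c v false))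
    <= \sum_(v | ~~ d v) 2 * total_risk L phi d c.
    rewrite /total_risk; under eq_bigr do rewrite -big_split /=.
    rewrite exchange_big /=; under [X in _ <= X]eq_bigr do rewrite big_distrr /=.
    rewrite [X in _ <= X]exchange_big /= !(big_seq _ _ phi).
    apply: leq_sum => C Cphi; move/allP: Ek => /(_ _ Cphi) /andP[uC /eqP sC].
    by apply: sum_risk_upd => //; rewrite sC.
  have := leq_add (half a) (half b); rewrite -!big_split /= /F /S => le.
  apply: leq_trans (leq_trans _ le) _; first apply: leq_sum => v _; try lia.
  by apply: leq_sum => v _; lia.
have [/existsP[v /andP[dv /orP H]]|] :=
  boolP [exists v, ~~ d v && ((F v true <= S) || (F v false <= S))].
  by case: H => H; exists v; [exists true | exists false].
move/existsPn => none.
suff : \sum_(v | ~~ d v) 2 * S < \sum_(v | ~~ d v) (F v true + F v false)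
  by rewrite ltnNge avg.
rewrite (bigD1 v0) //= [X in _ < X](bigD1 v0) //= -addSn; apply: leq_add.
  by have := none v0; rewrite dv0; lia.
by apply: leq_sum => v /andP[dv _]; have := none v; rewrite dv; lia.
Qed.

Lemma total_risk_init phi a : is_EkCNF k phi -> satisfies phi a ->
  total_risk L phi [ffun=> false] a = size phi * (L %/ k).
Proof.
move=> /allP Ek /allP sat; rewrite /total_risk big_seq.
transitivity (\sum_(C <- phi | C \in (phi : seq (seq ('I_n * bool)))) L %/ k).
  apply: eq_bigr => C Cphi; have /andP[_ /eqP sC] := Ek _ Cphi.
  rewrite /risk sat // ifN; last by apply/hasPn => l _; rewrite ffunE.
  rewrite -sC -count_predT; congr (_ %/ _).
  by apply: eq_count => l; rewrite ffunE.
by rewrite -big_seq big_const_seq count_predT iter_addn_0 mulnC.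
Qed.

(** A falsified clause has full risk [L], since a decided true literal would satisfy it. *)
Lemma unsat_le_total_risk phi d a :
  L * count (fun C => ~~ sat_clause a C) phi <= total_risk L phi d a.
Proof.
rewrite /total_risk; elim: phi => [|C phi IH] /=; first by rewrite big_nil muln0.
rewrite big_cons mulnDr; apply: leq_add IH.
have [//|unsat] := boolP (sat_clause a C); first by rewrite muln0.
rewrite muln1 /risk (negPf unsat) ifN //; apply: contra unsat.
by case/hasP=> l lC /andP[_ al]; apply/hasP; exists l.
Qed.

End Risk.

(** * The algorithm *)

Fixpoint lift (e : expr) : expr :=
  match e with
  | EVar x => EVar x.+1
  | ELeaf => ELeaf
  | ECons e1 e2 => ECons (lift e1) (lift e2)
  | EHd e1 => EHd (lift e1)
  | ETl e1 => ETl (lift e1)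
  end.

(** Data that do not depend on the instance are written into the program as constants. *)
Fixpoint quote (t : tree) : expr :=
  if t is Node l r then ECons (quote l) (quote r) else ELeaf.

Lemma eval_lift x env e : evale (x :: env) (lift e) = evale env e.
Proof. by elim: e => //= [e1 -> e2 ->|e ->|e ->]. Qed.

Lemma eval_quote st t : eval st (quote t) = t.
Proof. by elim: t => //= l -> r ->. Qed.

Lemma vars_in_quote P t : vars_in P (quote t).
Proof. by elim: t => //= l -> r ->. Qed.

Lemma slen_enc_nat m : slen (enc_nat m) = m.
Proof. by elim: m => //= m ->. Qed.

Lemma slen_enc_list T (enc : T -> tree) s : slen (enc_list enc s) = size s.
Proof. by elim: s => //= x s ->. Qed.

Lemma foldt_iter f y acc : foldt (fun _ => f) y acc = iter (slen y) f acc.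
Proof. by elim: y acc => //= _ _ r IH acc; rewrite IH -iterSr. Qed.

Lemma foldt_enc_list (A : eqType) B (enc : A -> tree) (encB : B -> tree) f
    (g : B -> A -> B) s b :
  (forall b x t, x \in s -> f (Node (enc x) t) (encB b) = encB (g b x)) ->
  foldt f (enc_list enc s) (encB b) = encB (foldl g b s).
Proof.
elim: s b => //= x s IH b fE; rewrite fE ?mem_head //; apply: IH => b' y t ys.
by apply: fE; rewrite inE ys orbT.
Qed.

(** A fold cannot stop early, so a search carries its first value other than [Leaf] to the end.
    Positions are named by the length of the tail. *)
Lemma foldt_first f (h : nat -> tree) y :
  (forall l r, slen r < slen y -> f (Node l r) Leaf = h (slen r)) ->
  (forall y l r, f y (Node l r) = Node l r) ->
  (foldt f y Leaf = Leaf /\ forall j, j < slen y -> h j = Leaf) \/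
  (exists2 j, j < slen y & foldt f y Leaf = h j /\ h j <> Leaf).
Proof.
move=> f0 f1; elim: y f0 => /= [|l _ r IH] f0; first by left.
rewrite f0 //; case E : (h (slen r)) => [|u v].
  case: IH => [l' r' lr|[-> H]|[j lj H]]; first by rewrite f0 // ltnW.
    by left; split=> // j; rewrite ltnS leq_eqVlt => /predU1P[->|/H].
  by right; exists j => //; exact: ltnW.
right; exists (slen r) => //; rewrite E; split=> //.
by elim: r {IH E f0} => //= l' _ r IH; rewrite f1.
Qed.

Definition tlist (s : seq tree) : tree := foldr Node Leaf s.

Lemma enc_listE T (enc : T -> tree) s : enc_list enc s = tlist (map enc s).
Proof. by rewrite /tlist foldr_map. Qed.

Lemma iter_tl_tlist j s : iter j tl_tree (tlist s) = tlist (drop j s).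
Proof. by elim: j s => [|j IH] [|x s] //; rewrite iterSr ?(IH [::]) //= IH. Qed.

Lemma hd_tlist s : hd_tree (tlist s) = nth Leaf s 0.
Proof. by case: s. Qed.

Lemma nth_enc_list (T : Type) (enc : T -> tree) x0 s j : j < size s ->
  hd_tree (iter j tl_tree (enc_list enc s)) = enc (nth x0 s j).
Proof.
by move=> lj; rewrite enc_listE iter_tl_tlist hd_tlist nth_drop addn0 (nth_map x0).
Qed.

Lemma hd_iter_assignment n (a : assignment n) (i : 'I_n) :
  hd_tree (iter i tl_tree (enc_assignment a)) = enc_bool (a i).
Proof. by rewrite (nth_enc_list _ i) ?size_enum_ord ?nth_ord_enum. Qed.

Lemma slen_enc_assignment n (a : assignment n) : slen (enc_assignment a) = n.
Proof. by rewrite slen_enc_list size_enum_ord. Qed.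

(** A zipper: the entries already passed, latest first, and the remaining list. [pop] also reverses
    the history at the end of the run. *)
Definition push (t : tree) : tree :=
  Node (Node (hd_tree (tl_tree t)) (hd_tree t)) (tl_tree (tl_tree t)).
Definition pop (t : tree) : tree :=
  Node (tl_tree (hd_tree t)) (Node (hd_tree (hd_tree t)) (tl_tree t)).

Lemma iter_push j s : j <= size s ->
  iter j push (Node Leaf (tlist s)) = Node (tlist (rev (take j s))) (tlist (drop j s)).
Proof.
elim: j => [|j IH] lj; first by rewrite take0 drop0.
rewrite iterS IH ?(ltnW lj) // (take_nth Leaf lj) rev_rcons (drop_nth Leaf lj).
by [].
Qed.

Lemma iter_pop s q :
  iter (size s) pop (Node (tlist s) (tlist q)) = Node Leaf (tlist (catrev s q)).
Proof.
elim: s q => // x s IH q.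
by rewrite iterSr -[pop _]/(Node (tlist s) (tlist (x :: q))) IH.
Qed.

Lemma enc_assignment_upd n (a : assignment n) (i : 'I_n) b :
  let s := [seq enc_bool (a j) | j <- enum 'I_n] in
  tlist (take i s ++ enc_bool b :: drop i.+1 s) = enc_assignment (upd a i b).
Proof.
move=> s; have ls : i < size s by rewrite size_map size_enum_ord.
rewrite /enc_assignment enc_listE; congr tlist.
have := set_nthE s Leaf i (enc_bool b); rewrite ls => <-.
apply: (@eq_from_nth _ Leaf) => [|j].
  by rewrite size_set_nth (maxn_idPr ls) !size_map.
rewrite size_set_nth (maxn_idPr ls) size_map size_enum_ord => lj.
rewrite nth_set_nth /= 2?(nth_map i) ?size_enum_ord // ffunE.
rewrite -[nth i _ j == i]/(nat_of_ord _ == nat_of_ord i) nth_enum_ord //.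
by case: eqP.
Qed.

(** * Terms for list access, clause risk and the search for a move *)

Local Notation V := EVar.
Local Notation ETrue := (ECons ELeaf ELeaf).

Definition drop_tm (idx lst : expr) : term := TFold idx lst (TE (ETl (V 0))).

(* The list is unwound onto a stack up to the position to be changed. *)
Definition set_tm (idx lst v : expr) : term :=
  TLet (TFold idx (ECons ELeaf lst)
    (TE (ECons (ECons (EHd (ETl (V 0))) (EHd (V 0))) (ETl (ETl (V 0))))))
 (TLet (TFold (lift idx) (ECons (EHd (V 0)) (ECons (lift v) (ETl (ETl (V 0)))))
    (TE (ECons (ETl (EHd (V 0))) (ECons (EHd (EHd (V 0))) (ETl (V 0))))))
 (TE (ETl (V 0)))).

Lemma ev_drop env idx lst :
  ev env (drop_tm idx lst) = iter (slen (evale env idx)) tl_tree (evale env lst).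
Proof. exact: (foldt_iter tl_tree). Qed.

Lemma ev_set env idx lst v n (a : assignment n) (i : 'I_n) b :
  slen (evale env idx) = i -> evale env lst = enc_assignment a ->
  evale env v = enc_bool b ->
  ev env (set_tm idx lst v) = enc_assignment (upd a i b).
Proof.
move=> Ei El Ev; rewrite /set_tm /=.
rewrite -/(push _) (foldt_iter push) -/(pop _) (foldt_iter pop) !eval_lift Ei El Ev.
set s := [seq enc_bool (a j) | j <- enum 'I_n].
have ss : size s = n by rewrite size_map size_enum_ord.
rewrite /enc_assignment enc_listE -/s iter_push ?ss ?(ltnW (ltn_ord i)) //=.
have {1}<- : size (rev (take i s)) = i by rewrite size_rev size_take ss ltn_ord.
rewrite (drop_nth Leaf) ?ss //= -[Node _ (tlist _)]/(tlist (_ :: _)).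
by rewrite iter_pop catrevE revK enc_assignment_upd.
Qed.

Opaque drop_tm.
Opaque set_tm.

(* The accumulator is (a decided literal is true, (an undecided literal is true,
   the suffix of the weight table starting at the number of undecided literals)). *)
Definition lit_tm (d a : expr) : term :=
  TLet (drop_tm (EHd (EHd (V 1))) d)
 (TLet (drop_tm (EHd (EHd (V 2))) (lift a))
 (TLet (TIf (EHd (V 0))
          (TIf (ETl (EHd (V 3))) (TE ETrue) (TE ELeaf))
          (TIf (ETl (EHd (V 3))) (TE ELeaf) (TE ETrue)))
 (TIf (V 0)
   (TIf (EHd (V 2)) (TE (ECons ETrue (ETl (V 3))))
      (TE (ECons (EHd (V 3)) (ECons ETrue (ETl (ETl (ETl (V 3))))))))
   (TIf (EHd (V 2)) (TE (V 3))
      (TE (ECons (EHd (V 3)) (ECons (EHd (ETl (V 3))) (ETl (ETl (ETl (V 3))))))))))).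

(** The count of undecided literals is kept as a number of tails taken of the weight table, so that
    the wanted weight is the head of what remains. *)
Definition lit_acc (tab : tree) (s : bool * bool * nat) : tree :=
  Node (enc_bool s.1.1) (Node (enc_bool s.1.2) (iter s.2 tl_tree tab)).

Definition lit_step n (d a : assignment n) (s : bool * bool * nat)
    (l : 'I_n * bool) : bool * bool * nat :=
  (s.1.1 || d l.1 && (a l.1 == l.2), s.1.2 || ~~ d l.1 && (a l.1 == l.2),
   ~~ d l.1 + s.2).

Lemma ev_lit env d_e a_e tab n (d a : assignment n) s (l : literal n) t :
  evale [:: lit_acc tab s, Node (enc_literal l) t & env] d_e = enc_assignment d ->
  evale [:: lit_acc tab s, Node (enc_literal l) t & env] a_e = enc_assignment a ->
  ev [:: lit_acc tab s, Node (enc_literal l) t & env] (lit_tm d_e a_e)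
  = lit_acc tab (lit_step d a s l).
Proof.
move=> Ed Ea; rewrite /lit_tm /= !ev_drop /= !eval_lift Ed Ea !slen_enc_nat.
rewrite !hd_iter_assignment /lit_acc /lit_step.
by case: s l {Ed Ea} => [[s c] r] [i b] /=; case: (d i); case: (a i); case: b;
  case: s; case: c.
Qed.

Lemma foldl_lit_step n (d a : assignment n) s C :
  foldl (lit_step d a) s C =
  (s.1.1 || has (fun l : literal n => d l.1 && (a l.1 == l.2)) C,
   s.1.2 || has (fun l : literal n => ~~ d l.1 && (a l.1 == l.2)) C,
   count (fun l : literal n => ~~ d l.1) C + s.2).
Proof.
elim: C s => [|l C IH] [[s c] r] /=; first by rewrite !orbF.
by rewrite IH /= -!orbA addnA [count _ _ + _]addnC.
Qed.

Opaque lit_tm.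

Definition sub_step (t : tree) : tree :=
  if hd_tree t is Node _ _ then Node (tl_tree (hd_tree t)) (tl_tree (tl_tree t))
  else t.

Lemma tl_enc_nat m : tl_tree (enc_nat m) = enc_nat m.-1.
Proof. by case: m. Qed.

(** A weight is a computed value and may not be folded over. The loop therefore runs a fixed number
    of times and idles once the weight is used up. *)
Lemma iter_sub_step j w B : w <= j ->
  iter j sub_step (Node (enc_nat w) (enc_nat B)) = Node Leaf (enc_nat (B - w)).
Proof.
elim: j w B => [|j IH] [|w] B //; rewrite ?subn0 // => lw; rewrite iterSr.
- by rewrite [sub_step _]/= (IH 0) ?subn0.
- by rewrite -[sub_step _]/(Node (enc_nat w) (tl_tree (enc_nat B)))
    tl_enc_nat (IH w) // -subn1 -subnDA add1n.
Qed.

(** The table starts at r = 0, with [L %/ 0 = 0], so that positions equal counts. *)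
Definition weights (k L : nat) : tree :=
  enc_list (fun r => enc_nat (L %/ r)) (iota 0 k.+1).

(** Returns what is left of the budget; truncated subtraction is harmless, as in the end only
    positivity is tested. [iter 4 lift] moves [d] and [a] below the binders of two folds. *)
Definition pay_tm (k L : nat) (phi d a bud : expr) : term :=
  TFold phi bud
 (TLet (TFold (EHd (V 1)) (ECons ELeaf (ECons ELeaf (quote (weights k L))))
    (lit_tm (iter 4 lift d) (iter 4 lift a)))
 (TIf (EHd (V 0)) (TE (V 1))
 (TLet (TIf (EHd (ETl (V 0))) (TE (EHd (ETl (ETl (V 0)))))
          (TE (quote (enc_nat L))))
 (TLet (TFold (quote (enc_nat L)) (ECons (V 0) (V 2))
    (TIf (EHd (V 0)) (TE (ECons (ETl (EHd (V 0))) (ETl (ETl (V 0))))) (TE (V 0))))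
 (TE (ETl (V 0))))))).

Lemma ev_pay env k L phi_e d_e a_e bud_e n (phi : cnf n) (d a : assignment n) B :
  is_EkCNF k phi ->
  evale env phi_e = enc_cnf phi -> evale env d_e = enc_assignment d ->
  evale env a_e = enc_assignment a -> evale env bud_e = enc_nat B ->
  ev env (pay_tm k L phi_e d_e a_e bud_e) = enc_nat (B - total_risk L phi d a).
Proof.
move=> Ek Ephi Ed Ea Eb; rewrite /pay_tm.
cbn [ev]; rewrite Ephi Eb.
pose g B (C : seq ('I_n * bool)) := B - risk L d a C.
rewrite (@foldt_enc_list _ _ _ enc_nat _ g); last first.
  move=> {Eb}B C t Cphi; cbn [ev].
  have sC : size C <= k by have /andP[_ /eqP->] := allP Ek _ Cphi.
  rewrite (_ : evale _ (ECons _ _) = lit_acc (weights k L) (false, false, 0)); last first.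
    by rewrite /= eval_quote.
  rewrite (_ : evale _ (EHd (V 1)) = enc_list (@enc_literal n) C) //.
  rewrite (@foldt_enc_list _ _ _ (lit_acc (weights k L)) _ (lit_step d a)); last first.
    by move=> s l u _; apply: ev_lit; rewrite /= !eval_lift.
  rewrite foldl_lit_step /= addn0 /g /risk.
  have [//|dtr] /= := boolP (has _ _); first by rewrite subn0.
  rewrite eval_quote.
  have -> : has (fun l : literal n => ~~ d l.1 && (a l.1 == l.2)) C = sat_clause a C.
    apply: eq_in_has => l lC; rewrite andbC; apply: andb_idr => al.
    by apply: contra dtr => dl; apply/hasP; exists l; rewrite // dl.
  rewrite (nth_enc_list _ 0); last by rewrite size_iota ltnS (leq_trans (count_size _ _)).
  rewrite nth_iota ?ltnS ?(leq_trans (count_size _ _)) // add0n.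
  (* The fold only uses the length [L] of its list, which is an upper bound for every weight. *)
  rewrite (_ : (fun y acc => _) = fun _ => sub_step) // foldt_iter slen_enc_nat.
  by case: (sat_clause a C); rewrite /= ?eval_quote iter_sub_step ?leq_div.
congr enc_nat; rewrite /total_risk.
elim: phi B {Ek Ephi Eb} => [|C phi IH] B /=; first by rewrite big_nil subn0.
by rewrite IH big_cons subnDA.
Qed.

Opaque pay_tm.

(* Environment: result so far, values left to try, [d] from the candidate on,
   outer result so far, suffix [ys] of the start assignment, loop state, outer
   loop, initial [d], budget, input.  The candidate variable is the length of
   the tail of [ys], so the same list serves as its unary code. *)
Definition try_tm (k L : nat) : term :=
  TLet (set_tm (ETl (V 4)) (EHd (V 5)) ETrue)
 (TLet (set_tm (ETl (V 5)) (EHd (ETl (V 6))) (EHd (V 2)))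
 (TLet (set_tm (ETl (V 6)) (EHd (ETl (ETl (V 7)))) (EHd (V 3)))
 (TLet (pay_tm k L (EHd (V 12)) (V 2) (V 1) (V 11))
 (TLet (pay_tm k L (EHd (V 13)) (V 3) (V 1) (V 0))
 (TIf (V 0) (TE (ECons (V 4) (ECons (V 3) (V 2)))) (TE ELeaf)))))).

(** [Leaf] means that no move has been found yet; a success is always a [Node]. *)
Definition search_tm (k L : nat) : term :=
  TFold (EHd (ETl (V 4))) ELeaf
 (TIf (V 0) (TE (V 0))
 (TLet (drop_tm (ETl (V 1)) (EHd (V 2)))
 (TIf (EHd (V 0)) (TE ELeaf)
 (TFold (quote (enc_list enc_bool [:: true; false])) ELeaf
 (TIf (V 0) (TE (V 0)) (try_tm k L)))))).

Definition enc_state n (d a b : assignment n) : tree :=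
  Node (enc_assignment d) (Node (enc_assignment a) (enc_assignment b)).

Definition affordable L n (phi : cnf n) (d a b : assignment n) B (v : 'I_n) s :=
  total_risk L phi (upd d v true) (upd a v s)
  + total_risk L phi (upd d v true) (upd b v s) <= B.

Section Search.

Variables (k L n : nat) (phi : cnf n) (d a b st0 : assignment n) (B : nat).
Variables (rest y dec0 tl_inp : tree).
Hypothesis Ek : is_EkCNF k phi.

Let acc := Node (enc_assignment d)
  (Node (enc_assignment a) (Node (enc_assignment b) rest)).
Let env := [:: acc; y; dec0; enc_nat B.+1;
  Node (enc_cnf phi) (Node (enc_assignment st0) tl_inp)].

Lemma ev_try (v : 'I_n) s f2 bs pd fnd ys :
  slen (tl_tree ys) = v -> hd_tree bs = enc_bool s ->
  ev [:: f2, bs, pd, fnd, ys & env] (try_tm k L)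
  = if affordable L phi d a b B v s
    then enc_state (upd d v true) (upd a v s) (upd b v s) else Leaf.
Proof.
move=> Ev Es; rewrite /try_tm /=.
rewrite (@ev_set _ (ETl (V 4)) _ _ n d v true) //.
rewrite (@ev_set _ (ETl (V 5)) _ _ n a v s) // (@ev_set _ (ETl (V 6)) _ _ n b v s) //.
set d' := upd d v true; set a' := upd a v s; set b' := upd b v s.
rewrite (@ev_pay _ k L (EHd (V 12)) _ _ _ n phi d' a' B.+1) //.
rewrite (@ev_pay _ k L (EHd (V 13)) _ _ _ n phi d' b'
  (B.+1 - total_risk L phi d' a')) //.
(* Starting from [B.+1], a positive remainder means a total risk of at most [B]. *)
rewrite -subnDA /affordable -ltnS -subn_gt0 -/d' -/a' -/b'.
by case: (B.+1 - _).
Qed.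

Opaque try_tm.

Lemma ev_search :
  (exists v s, ~~ d v /\ affordable L phi d a b B v s) ->
  exists v s, [/\ ~~ d v, affordable L phi d a b B v s
    & ev env (search_tm k L)
      = enc_state (upd d v true) (upd a v s) (upd b v s)].
Proof.
pose tr (v : 'I_n) s := if affordable L phi d a b B v s
    then enc_state (upd d v true) (upd a v s) (upd b v s) else Leaf.
(* The outcome at the variable with index [j], where [true] is tried before [false]. *)
pose h j := if insub j is Some v then
  if d v then Leaf else if tr v true is Node l r then Node l r else tr v false
  else Leaf.
have hE (v : 'I_n) : h v =
  if d v then Leaf else if tr v true is Node l r then Node l r else tr v false.
  by rewrite /h valK.
move=> [v [s [dv af]]]; rewrite /search_tm /=.
set f := (X in foldt X).
have f0 l r : slen r < slen (enc_assignment st0) -> f (Node l r) Leaf = h (slen r).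
  rewrite slen_enc_assignment => lr.
  rewrite -[slen r]/(nat_of_ord (Ordinal lr)) hE /f.
  rewrite ev_drop /= -[slen r]/(nat_of_ord (Ordinal lr)) hd_iter_assignment.
  case: (d _) => //=.
  rewrite (@ev_try (Ordinal lr) true _ (Node (Node Leaf Leaf) (Node Leaf Leaf))) //.
  rewrite (@ev_try (Ordinal lr) false) // /tr.
  by case: ifP.
have [//|[_ none]|[j lj [-> hj]]] := foldt_first f0.
- have := none v; rewrite slen_enc_assignment => /(_ (ltn_ord v)).
  by rewrite hE (negPf dv) /tr; case: s af => ->; case: ifP.
- move: lj hj; rewrite slen_enc_assignment => lj.
  rewrite -[j]/(nat_of_ord (Ordinal lj)) hE.
  case: (boolP (d _)) => // dj; rewrite /tr.
  case: ifP => [ok _|_]; first by exists (Ordinal lj), true.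
  by case: ifP => // ok _; exists (Ordinal lj), false.
Qed.

End Search.

(** * The whole run of the algorithm *)

(** Histories have the latest value first: reversing one and appending the other joins them at their
    common latest value. *)
Lemma catrev_path (T : Type) (e : rel T) (x0 a : T) p q : symmetric e ->
  path e a p -> path e a q ->
  [/\ ohead (catrev (a :: p) q) = Some (last a p),
      last x0 (catrev (a :: p) q) = last a q & sorted e (catrev (a :: p) q)].
Proof.
move=> e_sym; elim: p a q => [|x p IH] a q //= /andP[ax xp] aq.
have [] := IH x (a :: q) xp; first by rewrite /= e_sym ax.
by [].
Qed.

Lemma adjacent_sym n : symmetric (@adjacent n).
Proof.
move=> a b; rewrite /adjacent; congr (_ <= 1); apply: eq_card => i.
by rewrite !inE eq_sym.
Qed.

Lemma adjacent_upd n (a : assignment n) v s : adjacent (upd a v s) a.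
Proof.
rewrite /adjacent -(cards1 v) subset_leq_card //; apply/subsetP => i.
by rewrite !inE ffunE; case: (eqVneq i v) => //=; rewrite eqxx.
Qed.

(* The loop state is (d, (a, (b, (earlier values of a, values of b)))), both
   histories with the latest value first. *)
Definition step_tm (k L : nat) : term :=
  TLet (search_tm k L)
 (TE (ECons (EHd (V 0)) (ECons (EHd (ETl (V 0))) (ECons (ETl (ETl (V 0)))
   (ECons (ECons (EHd (ETl (V 1))) (EHd (ETl (ETl (ETl (V 1))))))
     (ECons (ETl (ETl (V 0))) (ETl (ETl (ETl (ETl (V 1))))))))))).

(* The budget is one more than the allowed risk, so that it must stay positive. *)
Definition main_tm (k L c : nat) : term :=
  TLet (TFold (EHd (V 0)) ETrue (TE (iter c (ECons ELeaf) (V 0))))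
 (TLet (TFold (EHd (ETl (V 1))) ELeaf (TE (ECons ELeaf (V 0))))
 (TLet (TFold (EHd (ETl (V 2)))
    (ECons (V 0) (ECons (EHd (ETl (V 2))) (ECons (ETl (ETl (V 2)))
      (ECons ELeaf (ECons (ETl (ETl (V 2))) ELeaf)))))
    (step_tm k L))
 (TLet (TFold (EHd (ETl (V 3)))
    (ECons (EHd (ETl (ETl (ETl (V 0))))) (ETl (ETl (ETl (ETl (V 0))))))
    (TE (ECons (ETl (EHd (V 0))) (ECons (EHd (EHd (V 0))) (ETl (V 0))))))
 (TE (ETl (V 0)))))).

Lemma vars_in_iter_cons P c e :
  vars_in P (iter c (ECons ELeaf) e) = vars_in P e.
Proof. by elim: c => //= c ->. Qed.

Lemma eval_iter_cons st c e :
  eval st (iter c (ECons ELeaf) e) = iter c (Node Leaf) (eval st e).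
Proof. by elim: c => //= c ->. Qed.

Transparent drop_tm set_tm lit_tm pay_tm try_tm.

(** Every fold runs over a part of the input or over a constant; computed values only serve as
    accumulators. *)
Lemma wf_main k L c : wf [:: true] (main_tm k L c).
Proof. by rewrite /= !vars_in_quote vars_in_iter_cons. Qed.

Opaque drop_tm set_tm lit_tm pay_tm try_tm search_tm.

Definition enc_run n (d a b : assignment n) (sa sb : seq (assignment n)) : tree :=
  Node (enc_assignment d) (Node (enc_assignment a) (Node (enc_assignment b)
    (Node (enc_list (@enc_assignment n) sa) (enc_list (@enc_assignment n) sb)))).

Section Run.

Variables (k L n : nat) (phi : cnf n) (a0 b0 : assignment n).
Hypothesis dvdL : forall r, 0 < r <= k -> r %| L.
Hypothesis Ek : is_EkCNF k phi.

Let B := size phi * (2 * (L %/ k)).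

(** For [k] dividing a positive [L]: at most 2m/k of the m clauses are falsified. *)
Definition low_risk (x : assignment n) : bool :=
  L * count (fun C => ~~ sat_clause x C) phi <= size phi * (2 * (L %/ k)).

(** At [j = n] every variable is decided, and [inv_agree] makes the two copies meet. *)
Record run_inv (j : nat) (d a b : assignment n) (sa sb : seq (assignment n)) :
    Prop := RunInv {
  inv_card : #|[set v | d v]| = j;
  inv_sizea : size sa = j;
  inv_sizeb : size sb = j;
  inv_agree : forall v, d v -> a v = b v;
  inv_risk : total_risk L phi d a + total_risk L phi d b <= B;
  inv_patha : path (@adjacent n) a sa;
  inv_pathb : path (@adjacent n) b sb;
  inv_lasta : last a sa = a0;
  inv_lastb : last b sb = b0;
  inv_low : all low_risk (a :: b :: sa ++ sb) }.

Lemma low_risk_total d a b : total_risk L phi d a + total_risk L phi d b <= B ->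
  low_risk a /\ low_risk b.
Proof.
move=> le; split; apply: leq_trans (unsat_le_total_risk _ _ d _) _;
  by apply: leq_trans le; rewrite (leq_addr, leq_addl).
Qed.

Lemma run_inv0 : satisfies phi a0 -> satisfies phi b0 ->
  run_inv 0 [ffun=> false] a0 b0 [::] [::].
Proof.
move=> sat_a sat_b.
have risk0 : total_risk L phi [ffun=> false] a0 + total_risk L phi [ffun=> false] b0 <= B.
  by rewrite !(@total_risk_init k) // /B -mulnDr addnn mul2n.
split=> //=.
- by apply: eq_card0 => v; rewrite !inE ffunE.
- by move=> v; rewrite ffunE.
- by have [-> ->] := low_risk_total risk0.
Qed.

Lemma ev_step j d a b sa sb y dec0 : j < n -> run_inv j d a b sa sb ->
  exists d' a' b' sa' sb', run_inv j.+1 d' a' b' sa' sb' /\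
    ev [:: enc_run d a b sa (b :: sb); y; dec0; enc_nat B.+1; enc_instance phi a0 b0]
      (step_tm k L) = enc_run d' a' b' sa' (b' :: sb').
Proof.
move=> jn I.
have [v dv] : exists v, ~~ d v.
  apply/existsP; rewrite -negb_forall; apply/forallP => alld.
  suff : #|[set v | d v]| = n by rewrite (inv_card I); lia.
  by rewrite -[RHS]card_ord; apply: eq_card => v; rewrite !inE alld.
(* This move shows that the search succeeds; the search may return another affordable move. *)
have [v1 [s1 [dv1 le1]]] := good_move dvdL a b Ek (ex_intro _ v dv).
have [|v' [s [dv' af E]]] := @ev_search k L n phi d a b a0 B
  (Node (enc_list (@enc_assignment n) sa) (enc_list (@enc_assignment n) (b :: sb)))
  y dec0 (enc_assignment b0) Ek.
  by exists v1, s1; split=> //; apply: leq_trans le1 (inv_risk I).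
exists (upd d v' true), (upd a v' s), (upd b v' s), (a :: sa), (b :: sb).
split; last by rewrite /step_tm /= E.
case: I => Ic Iza Izb Iag Ir Ipa Ipb Ila Ilb Ilow.
split=> //=; rewrite ?Iza ?Izb ?adjacent_upd //.
- have -> : [set v | upd d v' true v] = v' |: [set v | d v].
    by apply/setP => i; rewrite !inE ffunE; case: eqP.
  by rewrite cardsU1 inE dv' Ic.
- by move=> i; rewrite !ffunE; case: eqP => // _; exact: Iag.
- have [-> ->] := low_risk_total af.
  by move: Ilow; rewrite /= !all_cat /= => /and4P[-> -> -> ->].
Qed.

Opaque step_tm.

Lemma ev_steps j d a b sa sb dec0 y : j + slen y = n -> run_inv j d a b sa sb ->
  exists d' a' b' sa' sb', run_inv n d' a' b' sa' sb' /\
    foldt (fun y acc => ev [:: acc; y; dec0; enc_nat B.+1; enc_instance phi a0 b0]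
      (step_tm k L)) y (enc_run d a b sa (b :: sb)) = enc_run d' a' b' sa' (b' :: sb').
Proof.
elim: y j d a b sa sb => [|l _ r IH] j d a b sa sb /=.
  by rewrite addn0 => Ej I; exists d, a, b, sa, sb; split=> //; rewrite Ej in I.
move=> En I; have jn : j < n by rewrite -En addnS ltnS leq_addr.
have [d1 [a1 [b1 [sa1 [sb1 [I1 E1]]]]]] := ev_step (Node l r) dec0 jn I.
by rewrite E1; apply: (IH j.+1) => //; rewrite addSnnS.
Qed.

Lemma ev_main : satisfies phi a0 -> satisfies phi b0 ->
  exists s, [/\ ev [:: enc_instance phi a0 b0] (main_tm k L (2 * (L %/ k)))
      = enc_list (@enc_assignment n) s,
    reconf_seq a0 b0 s, size s = (2 * n).+1 & all low_risk s].
Proof.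
move=> sat_a sat_b; rewrite /main_tm /=.
(* The budget starts at 1 and grows by [2 * (L %/ k)] for each clause. *)
have -> : foldt (fun y acc => evale [:: acc; y; enc_instance phi a0 b0]
    (iter (2 * (L %/ k)) (ECons ELeaf) (V 0))) (enc_cnf phi) (Node Leaf Leaf)
  = enc_nat B.+1.
  transitivity (foldt (fun _ => iter (2 * (L %/ k)) (Node Leaf))
    (enc_cnf phi) (enc_nat 1)).
    rewrite -[Node Leaf Leaf]/(enc_nat 1).
    by elim: (enc_cnf phi) (enc_nat 1) => //= l _ r IH acc; rewrite IH eval_iter_cons.
  rewrite foldt_iter slen_enc_list /B; elim: (size phi) => // m IH.
  by rewrite iterS IH /enc_nat -iterD mulSn addnS.
have -> : foldt (fun _ acc => Node Leaf acc) (enc_assignment a0) Leaf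
  = enc_assignment ([ffun=> false] : assignment n).
  rewrite (foldt_iter (Node Leaf)) slen_enc_assignment /enc_assignment.
  rewrite -{1}(size_enum_ord n).
  by elim: (enum 'I_n) => //= i s ->; rewrite ffunE.
have [|d [a [b [sa [sb [I E]]]]]] := @ev_steps 0 _ _ _ _ _
  (enc_assignment ([ffun=> false] : assignment n)) (enc_assignment a0)
  _ (run_inv0 sat_a sat_b).
  by rewrite slen_enc_assignment.
move: E; rewrite [enc_run _ a0 _ _ _]/enc_run /= => ->; rewrite /enc_run /=.
have ab : a = b.
  apply/ffunP => v; apply: (inv_agree I).
  have : [set v | d v] == setT
    by rewrite eqEcard subsetT cardsT card_ord (inv_card I) leqnn.
  by move/eqP/setP/(_ v); rewrite !inE.
have [|oh la so] :=
  @catrev_path _ (@adjacent n) a0 a sa sb (@adjacent_sym n) (inv_patha I).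
  by rewrite ab (inv_pathb I).
exists (catrev (a :: sa) sb); split.
(* The [n] pops unwind exactly [sa] onto [b :: sb]; since [a = b], the meeting point is listed
   once. *)
- rewrite (foldt_iter pop) slen_enc_assignment -{1}(inv_sizea I) ab.
  rewrite -(size_map (@enc_assignment n)) !enc_listE.
  rewrite -[Node _ (tlist _)]/(tlist (map (@enc_assignment n) (b :: sb))) iter_pop.
  by rewrite [tl_tree _]/= !catrevE map_cat map_rev /= rev_cons cat_rcons.
- by split; [rewrite oh (inv_lasta I) | rewrite la ab (inv_lastb I) |].
- by rewrite catrevE size_cat size_rev /= (inv_sizea I) (inv_sizeb I) mul2n -addnn addSn.
- have := inv_low I; rewrite catrevE all_cat all_rev /= all_cat.
  by move=> /and4P[-> _ -> ->].
Qed.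

End Run.

(** * The approximation guarantee *)

Lemma rdepth_enc_list (T : eqType) (enc : T -> tree) s m :
  (forall x, x \in s -> rdepth (enc x) <= m) ->
  rdepth (enc_list enc s) <= m + size s.
Proof.
elim: s => //= x s IH le.
have lex := le x (mem_head _ _).
have {}IH : rdepth (enc_list enc s) <= m + size s.
  by apply: IH => y ys; apply: le; rewrite inE ys orbT.
lia.
Qed.

Lemma rdepth_enc_bool b : rdepth (enc_bool b) <= 1.
Proof. by case: b. Qed.

Lemma rdepth_enc_nat m : rdepth (enc_nat m) = m.
Proof. by elim: m => //= m ->; rewrite max0n. Qed.

Lemma rdepth_enc_assignment n (a : assignment n) : rdepth (enc_assignment a) <= n.+1.
Proof.
rewrite -add1n -{2}(size_enum_ord n); apply: rdepth_enc_list => i _.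
exact: rdepth_enc_bool.
Qed.

(** As [k] is positive, no clause is empty and the number of clauses is at most the number of
    literal occurrences. *)
Lemma rdepth_enc_instance k n (phi : cnf n) (a b : assignment n) : 0 < k ->
  is_EkCNF k phi -> rdepth (enc_instance phi a b) <= cnf_size phi + (k + 3).
Proof.
move=> k0 Ek.
have la := rdepth_enc_assignment a; have lb := rdepth_enc_assignment b.
have lp : rdepth (enc_cnf phi) <= n + 2 + k + size phi.
  apply: (@rdepth_enc_list (seq ('I_n * bool))) => C /(allP Ek) /andP[_ /eqP <-].
  apply: (@rdepth_enc_list ('I_n * bool)%type) => -[i s] _.
  rewrite /enc_literal /= rdepth_enc_nat.
  by have := rdepth_enc_bool s; have := ltn_ord i; lia.
have sp : size phi <= sumn (map size phi).
  elim: phi Ek {lp} => //= C phi IH /andP[/andP[_ /eqP sC] /IH].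
  rewrite sC; lia.
rewrite /enc_instance /cnf_size [rdepth _]/=; lia.
Qed.

(** Cancelling [k! / k] leaves [k * u <= 2 * size phi], so the value is at least 1 - 2/k, and 1/k <=
    1/(k-1). *)
Lemma low_risk_val k n (phi : cnf n) (x : assignment n) : 3 <= k ->
  low_risk k k`! phi x -> (approx_factor k <= val_cnf phi x)%R.
Proof.
move=> k3; rewrite /low_risk; set u := count _ phi => le.
have k0 : 0 < k by lia.
have le2 : k * u <= 2 * size phi.
  have /dvdnP[q Eq] : k %| k`! by rewrite dvdn_fact // k0 leqnn.
  have q0 : 0 < q by have := fact_gt0 k; rewrite Eq muln_gt0 => /andP[].
  rewrite -(leq_pmul2l q0); move: le; rewrite Eq mulnK // -mulnA.
  by rewrite [X in _ <= X -> _]mulnA [X in _ <= X -> _]mulnC [size phi * 2]mulnC.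
have kR : (3 <= k%:R :> rat)%R by rewrite ler_nat.
have fac : (approx_factor k <= 1 - 2 / k%:R)%R.
  rewrite /approx_factor.
  have -> : (2 / k%:R = 1 / k%:R + 1 / k%:R :> rat)%R by rewrite -mulrDl.
  suff : (1 / k%:R <= 1 / (k%:R - 1) :> rat)%R by lra.
  by rewrite !div1r lef_pV2 ?posrE; lra.
apply: le_trans fac _; rewrite /val_cnf.
case E : phi => [|C phi']; first by rewrite gerBl divr_ge0 ?ler0n.
rewrite -E; have m0 : (0 < (size phi)%:R :> rat)%R by rewrite ltr0n E.
have Ec : ((count (sat_clause x) phi)%:R = (size phi)%:R - u%:R :> rat)%R.
  by rewrite -(count_predC (sat_clause x) phi) natrD addrK.
rewrite Ec mulrBl divff ?gt_eqF // lerD2l lerN2.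
rewrite ler_pdivrMr // mulrAC ler_pdivlMr; last by lra.
by rewrite -!natrM ler_nat mulnC.
Qed.

(** The sign allows multiplying the factor by an optimum of at most 1. *)
Lemma approx_factor_ge0 k : 3 <= k -> (0 <= approx_factor k)%R.
Proof.
move=> k3; have kR : (3 <= k%:R :> rat)%R by rewrite ler_nat.
rewrite /approx_factor !div1r.
have h1 : ((k%:R - 1)^-1 <= 2^-1 :> rat)%R by rewrite lef_pV2 ?posrE; lra.
have h2 : (k%:R^-1 <= 3^-1 :> rat)%R by rewrite lef_pV2 ?posrE; lra.
lra.
Qed.

Lemma approx_factor_le1 k : 3 <= k -> (approx_factor k <= 1)%R.
Proof.
move=> k3; have kR : (3 <= k%:R :> rat)%R by rewrite ler_nat.
rewrite /approx_factor !div1r.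
have h1 : (0 < (k%:R - 1)^-1 :> rat)%R by rewrite invr_gt0; lra.
have h2 : (0 < k%:R^-1 :> rat)%R by rewrite invr_gt0; lra.
lra.
Qed.

Lemma val_seq_ge n (phi : cnf n) s (r : rat) : (r <= 1)%R ->
  (forall a, a \in (s : seq {ffun 'I_n -> bool}) -> r <= val_cnf phi a)%R ->
  (r <= val_seq phi s)%R.
Proof.
move=> r1 le; rewrite /val_seq big_seq.
by apply: (big_ind (fun v => r <= v)%R) => // x y rx ry; rewrite le_min rx.
Qed.

Lemma val_seq_le1 n (phi : cnf n) s : (val_seq phi s <= 1)%R.
Proof.
rewrite /val_seq; elim: s => [|a s IH]; first by rewrite big_nil.
by rewrite big_cons ge_min IH orbT.
Qed.

(** Excluded middle stands in for decidability of [Q]. *)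
Lemma finite_max (vals : seq rat) (Q : rat -> Prop) :
  (forall v, Q v -> v \in vals) -> (exists v, Q v) ->
  exists v, Q v /\ forall w, Q w -> (w <= v)%R.
Proof.
elim: vals Q => [|x vals IH] Q inv [v Qv]; first by have := inv _ Qv.
have [[w Qw]|none] := classic (exists w, Q w /\ w != x); last first.
  exists v; split=> // w Qw; suff E u : Q u -> u = x by rewrite (E _ Qw) (E _ Qv).
  by move=> Qu; apply/eqP/negPn/negP => ux; apply: none; exists u.
have [|u [[Qu ux] max_u]] := IH (fun w => Q w /\ w != x) _ (ex_intro _ w Qw).
  by move=> y [/inv]; rewrite inE => /predU1P[->|//]; rewrite eqxx.
have [Qx|nQx] := classic (Q x).
  have [le|/ltW le] := leP x u; [exists u | exists x]; split=> // y Qy;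
    have [->//|yx] := eqVneq y x; first exact: max_u.
  exact: le_trans (max_u _ _) le.
exists u; split=> // y Qy; apply: max_u; split=> //.
by apply/eqP => yx; rewrite yx in Qy.
Qed.

(** There are infinitely many sequences, but their values are 1 or of the form c/m with c <= m, so a
    maximum is attained. *)
Lemma is_opt_exists n (phi : cnf n) (a b : assignment n) :
  (exists s, reconf_seq a b s) -> exists v, is_opt phi a b v.
Proof.
move=> [s0 rs0].
pose vals := 1%R :: [seq (c%:R / (size phi)%:R)%R : rat | c <- iota 0 (size phi).+1].
have [|| v [[s rs Es] max_v]] :=
  @finite_max vals (fun v => exists2 s, reconf_seq a b s & val_seq phi s = v).
- move=> _ [s _ <-]; rewrite /val_seq.
  apply: (big_ind (fun v => v \in vals)) => [|x y xv yv|x _].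
  + exact: mem_head.
  + by rewrite minEle; case: ifP.
  + rewrite /vals inE /val_cnf; case E : phi => [//|C phi']; rewrite -E.
    apply/orP; right; apply/mapP; exists (count (sat_clause x) phi) => //.
    by rewrite mem_iota add0n ltnS count_size.
- by exists (val_seq phi s0), s0.
exists v; split; first by exists s.
by move=> s' rs'; apply: max_v; exists s'.
Qed.

(** The input in variable 0 is the environment of depth 1. [k!] serves as the common multiple
    [L]. *)
Definition algorithm (k : nat) : cmd :=
  Seq (compile 1 (main_tm k k`! (2 * (k`! %/ k)))) (Assign 0 (EVar 1)).

Lemma algorithm_spec k : 3 <= k ->
  finds_in_poly_time k (algorithm k) (fun n phi a b s =>
    [/\ reconf_seq a b s, size s = (2 * n).+1
      & (approx_factor k <= val_seq phi s)%R]).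
Proof.
move=> k3; set t := main_tm k k`! (2 * (k`! %/ k)).
(* The input, the only read-only value, has spines of length at most [cnf_size phi + (k + 3)]. The 2
   added to [q] below pays for the final copy. *)
have [q Eq] := cost_horner t 1 (k + 3).
exists (q + 2%:P)%R => n phi a b [Ek _ sat_a sat_b].
have dvdL r : 0 < r <= k -> r %| k`! by move=> rk; rewrite dvdn_fact.
have [s [Es rs ss lows]] := ev_main dvdL Ek sat_a sat_b.
have [|||T [st [X C Vst F]]] := @compile_exec t [:: enc_instance phi a b] [:: true]
  (init_store (enc_instance phi a b)) (1 * cnf_size phi + (k + 3)) (wf_main _ _ _).
- by case.
- by [].
- case=> [|[]] //= _; rewrite mul1n; apply: rdepth_enc_instance => //; lia.
exists s; eexists; split.
- eexists; first by apply: ExecSeq X _; apply: ExecAssign.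
  by rewrite /update /= Vst.
- by rewrite hornerD hornerC -Eq leq_add2r.
- split=> //; apply: val_seq_ge => [|x xs]; first exact: approx_factor_le1.
  by apply: low_risk_val => //; exact: (allP lows).
Qed.

Local Open Scope ring_scope.

Theorem theorem5p1 (k : nat) (hk : (3 <= k)%N) :
  exists p : {poly nat},
    (forall (n : nat) (phi : cnf n) (a_start a_end : assignment n),
      is_instance k phi a_start a_end ->
      exists s : seq (assignment n),
        [/\ reconf_seq a_start a_end s,
            (size s <= p.[cnf_size phi])%N
          & approx_factor k <= val_seq phi s]) /\
    (exists A : cmd,
      finds_in_poly_time k A (fun n phi a_start a_end s =>
        [/\ reconf_seq a_start a_end s,
            (size s <= p.[cnf_size phi])%N
          & approx_factor k <= val_seq phi s]) /\
      is_approx_algorithm k (approx_factor k) A).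
Proof.
have [q spec] := algorithm_spec hk.
(* The sequences have length [2 * n + 1], and [n] is at most [cnf_size phi]. *)
pose p : {poly nat} := 2%:P * 'X + 1%:P.
have size_p n (phi : cnf n) (s : seq (assignment n)) :
  size s = (2 * n).+1%N -> (size s <= p.[cnf_size phi])%N.
  move=> ->; rewrite /p !(hornerD, hornerM, hornerC, hornerX) -addn1.
  by rewrite leq_add2r leq_mul2l leq_addr.
exists p; split=> [n phi a b inst|].
  have [s [t [_ _ [rs ss vs]]]] := spec n phi a b inst.
  by exists s; split=> //; exact: size_p.
exists (algorithm k); split; exists q => n phi a b inst;
  have [s [t [out tq [rs ss vs]]]] := spec n phi a b inst; exists s, t.
  by split=> //; split=> //; exact: size_p.
split=> //; split=> //.
have [v opt] := is_opt_exists phi (ex_intro _ s rs).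
(* The optimum is at most 1, so the factor times the optimum is at most the factor. *)
exists v => //; apply: le_trans vs; apply: ler_piMr; first exact: approx_factor_ge0.
by have [[s' _ <-] _] := opt; exact: val_seq_le1.
Qed.
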